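(* Let $t,m,n$ be positive integers, $V=\mathbb{C}^t$, $W=\mathbb{C}^{m+n}$, and let $\Omega_{ij}$, $E_{ij}$, $\kappa_{ij}$ ($1\le i,j\le m+n$) be the operators on $\Lambda^{\bullet}(V\otimes W)$ defined in the context. Fix a $\mathfrak{gl}_t$-weight $\alpha$ and a $\mathfrak{gl}_{m+n}$-weight $\beta=(\beta_1,\dots,\beta_{m+n})$, and let $M_{\alpha,\beta}\subset\Lambda^{\bullet}(V\otimes W)$ be the subspace of vectors of $\mathfrak{gl}_t$-weight $\alpha$ and $\mathfrak{gl}_{m+n}$-weight $\beta$ (so $E_{ii}$ acts on it by $\beta_i$). Let $\hbar\in\mathbb{C}$ and $U=\{z\in\mathbb{C}^{m+n}: z_i\neq z_j \text{ for } i\ne j\}$. Then a (local holomorphic) function $f:U\to M_{\alpha,\beta}$ is a flat section of $$\nabla_{KZ}=d-\hbar\sum_{1\le i<j\le m+n}\frac{dz_i-dz_j}{z_i-z_j}\Omega_{ij}$$ if and only if $g=f\cdot\prod_{1\le i<j\le m+n}(z_i-z_j)^{-(\beta_i+\beta_j)\hbar/2}$ is a flat section of $$\nabla_\kappa=d+\frac{\hbar}{2}\sum_{1\le i<j\le m+n}\frac{dz_i-dz_j}{z_i-z_j}\kappa_{ij}.$$ Moreover, with $h=\exp\big(\frac{\hbar}{2}\sum_{1\le i<j\le m+n}(\beta_i-\beta_j)\log(z_i-z_j)\big)$, the gauge transform $h\nabla_\kappa h^{-1}$ on $M_{\alpha,\beta}$ equals the dynamical connection $$\nabla_D=d+\hbar\sum_{1\le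 i<j\le m+n}\frac{dz_i-dz_j}{z_i-z_j}E_{ji}E_{ij}.$$
   Context: $V$ has standard basis $v_1,\dots,v_t$, $W$ has standard basis $w_1,\dots,w_{m+n}$, $x_{a,i}=v_a\otimes w_i$. On $\Lambda^{\bullet}(V\otimes W)$, $x_{a,i}$ is left multiplication and $\partial_{a,i}$ is the odd derivation with $\partial_{a,i}(x_{b,j})=\delta_{ab}\delta_{ij}$. Define $\Omega_{ij}=\sum_{a,b=1}^t x_{a,i}\partial_{b,i}x_{b,j}\partial_{a,j}$ (the $\mathfrak{gl}_t$ Casimir acting in the $i$-th and $j$-th factors of $\Lambda^{\bullet}(V\otimes W)\cong\bigotimes_i\Lambda^{\bullet}(V\otimes w_i)$), $E_{ij}=\sum_{a=1}^t x_{a,i}\partial_{a,j}$ (the action of $\mathfrak{gl}_{m+n}$), and $\kappa_{ij}=E_{ij}E_{ji}+E_{ji}E_{ij}$. The $\mathfrak{gl}_t$-action is $E_{ab}\mapsto\sum_i x_{a,i}\partial_{b,i}$; weights are with respect to diagonal matrices. *)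

(* Defs.v *)
From mathcomp Require Import all_boot all_algebra.
From mathcomp Require Import complex.
From mathcomp Require Import all_classical all_reals all_analysis.
Set Implicit Arguments.
Unset Strict Implicit.
Unset Printing Implicit Defensive.
Import GRing.Theory Num.Theory.
Local Open Scope ring_scope.

(* The exterior algebra  Λ(V ⊗ W),  V = C^t, W = C^N (N = m+n).              *)
(* Generators x_{a,i} = v_a ⊗ w_i are indexed by gen t N = 'I_t * 'I_N.       *)
(* A vector of Λ is given by its coordinates in the monomial basis            *)
(* e_S = x_{p1} ∧ ... ∧ x_{pk} (S = {p1 < ... < pk}), the generators being    *)
(* totally ordered by enum_rank.                                             *)

Definition gen (t N : nat) := ('I_t * 'I_N)%type.

Definition Lam (R : realType) (t N : nat) := {ffun {set gen t N} -> R[i]}.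

Definition sgn_before (R : realType) (t N : nat) (S : {set gen t N}) (p : gen t N)
  : R[i] := (-1) ^+ #|[set l in S | (enum_rank l < enum_rank p)%N]|.

(* left multiplication by x_p :  x_p e_T = [p \notin T] (-1)^{#{l in T, l<p}} e_{T ∪ p} *)
Definition xop (R : realType) (t N : nat) (p : gen t N) (v : Lam R t N)
  : Lam R t N :=
  [ffun S : {set gen t N} => if p \in S then sgn_before R (S :\ p) p * v (S :\ p) else 0].

(* the odd derivation ∂_p with ∂_p(x_q) = δ_{pq}:
   ∂_p e_T = [p \in T] (-1)^{#{l in T, l<p}} e_{T \ p} *)
Definition dop (R : realType) (t N : nat) (p : gen t N) (v : Lam R t N)
  : Lam R t N :=
  [ffun S : {set gen t N} => if p \in S then 0 else sgn_before R S p * v (p |: S)].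

Definition Eop (R : realType) (t N : nat) (i j : 'I_N) (v : Lam R t N) : Lam R t N :=
  \sum_(a < t) xop (a, i) (dop (a, j) v).

Definition Omega (R : realType) (t N : nat) (i j : 'I_N) (v : Lam R t N) : Lam R t N :=
  \sum_(a < t) \sum_(b < t) xop (a, i) (dop (b, i) (xop (b, j) (dop (a, j) v))).

Definition kappa (R : realType) (t N : nat) (i j : 'I_N) (v : Lam R t N) : Lam R t N :=
  Eop i j (Eop j i v) + Eop j i (Eop i j v).

Definition EjiEij (R : realType) (t N : nat) (i j : 'I_N) (v : Lam R t N) : Lam R t N :=
  Eop j i (Eop i j v).

Definition Etop (R : realType) (t N : nat) (a b : 'I_t) (v : Lam R t N) : Lam R t N :=
  \sum_(i < N) xop (a, i) (dop (b, i) v).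

Definition inM (R : realType) (t N : nat) (alpha : 'I_t -> R[i]) (beta : 'I_N -> R[i])
  (v : Lam R t N) : Prop :=
  (forall a : 'I_t, Etop a a v = alpha a *: v) /\
  (forall i : 'I_N, Eop i i v = beta i *: v).

Definition Uconf (R : realType) (N : nat) : set 'rV[R[i]]_N :=
  [set z | forall i j : 'I_N, i != j -> z ord0 i != z ord0 j].

Definition ek (R : realType) (N : nat) (k : 'I_N) : 'rV[R[i]]_N := delta_mx 0 k.

Definition holoC (R : realType) (N : nat) (D : set 'rV[R[i]]_N)
  (F : 'rV[R[i]]_N -> R[i]) : Prop :=
  forall z, D z -> differentiable (F : 'rV[R[i]]_N -> (R[i])^o) (z : ('rV[R[i]]_N : normedModType R[i])).

Definition holo (R : realType) (t N : nat) (D : set 'rV[R[i]]_N)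
  (F : 'rV[R[i]]_N -> Lam R t N) : Prop :=
  forall S, holoC D (fun w => F w S).

Definition pd (R : realType) (t N : nat) (k : 'I_N) (F : 'rV[R[i]]_N -> Lam R t N)
  (z : 'rV[R[i]]_N) : Lam R t N :=
  [ffun S : {set gen t N} => 'D_(@ek R N k) ((fun w => F w S) : 'rV[R[i]]_N -> (R[i])^o)
       (z : ('rV[R[i]]_N : normedModType R[i]))].

(* dz_k-component of  sum_{i<j} (dz_i - dz_j)/(z_i - z_j) P_{ij}, applied to v *)
Definition conn (R : realType) (t N : nat) (P : 'I_N -> 'I_N -> Lam R t N -> Lam R t N)
  (z : 'rV[R[i]]_N) (k : 'I_N) (v : Lam R t N) : Lam R t N :=
  \sum_(i < N) \sum_(j < N | (i < j)%N)
     ((((i == k)%:R - (j == k)%:R) / (z ord0 i - z ord0 j)) *: P i j v).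

Definition flat (R : realType) (t N : nat) (D : set 'rV[R[i]]_N) (c : R[i])
  (P : 'I_N -> 'I_N -> Lam R t N -> Lam R t N) (f : 'rV[R[i]]_N -> Lam R t N) : Prop :=
  forall z, D z -> forall k : 'I_N, pd k f z + c *: conn P z k (f z) = 0.

Definition expC (R : realType) (z : R[i]) : R[i] :=
  limn ((fun n : nat => \sum_(k < n) (z ^+ k / k`!%:R)) : nat -> (R[i])^o).

Definition log_branch (R : realType) (N : nat) (D : set 'rV[R[i]]_N) (i j : 'I_N)
  (L : 'rV[R[i]]_N -> R[i]) : Prop :=
  holoC D L /\ forall z, D z -> expC (L z) = z ord0 i - z ord0 j.

(* Main.v *)
(* The operators x_p, d_p satisfy the canonical anticommutation relations, so for
   i <> j one has E_ij E_ji = E_ii - Omega_ij and E_ji E_ij = E_jj - Omega_ij.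
   Hence on M_{alpha,beta} the connection forms of nabla_KZ, nabla_kappa and
   nabla_D differ by scalar forms sum_{i<j} c_ij dlog(z_i - z_j), and such a form
   is gauged away by exp(sum_{i<j} c_ij log(z_i - z_j)). Any holomorphic branch
   of log(z_i - z_j) has the right differential because exp' = exp; this, with
   exp(x + y) = exp x exp y, is obtained for the complex exponential by estimating
   partial sums by the corresponding real ones. *)
From HB Require Import structures.
Require Import Defs.
From mathcomp Require Import all_boot all_order all_algebra.
From mathcomp Require Import complex.
From mathcomp Require Import all_classical all_reals all_analysis.
From mathcomp Require Import ring.
Import Order.TTheory GRing.Theory Num.Theory.
Import numFieldNormedType.Exports.
Local Open Scope ring_scope.
Local Open Scope classical_set_scope.

(** * Canonical anticommutation relations and the operator identities on the exterior algebra *)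

Section Fock.
Set Implicit Arguments.
Unset Strict Implicit.
Variables (R : realType) (t N : nat).
Implicit Types (S : {set gen t N}) (p q : gen t N) (v w : Lam R t N).

Let ltg p q : bool := (enum_rank p < enum_rank q)%N.

(** Inserting [p] raises the number of generators before [q] by one exactly when [p] precedes
    [q]. *)
Lemma sgn_beforeU S p q : p \notin S ->
  sgn_before R (p |: S) q = (-1) ^+ ltg p q * sgn_before R S q.
Proof.
move=> pS; rewrite /sgn_before -exprD; congr (_ ^+ _).
rewrite (cardsD1 p) !inE eqxx /=; congr (_ + _)%N.
apply: eq_card => l; rewrite !inE.
by case: eqP => [->|//]; rewrite (negbTE pS).
Qed.

Lemma sgn_beforeD S p q : p \in S ->
  sgn_before R (S :\ p) q = (-1) ^+ ltg p q * sgn_before R S q.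
Proof.
move=> pS; rewrite -{2}(finset.setD1K pS) sgn_beforeU ?finset.setD11// mulrA -exprD.
by rewrite addnn -mul2n exprM sqrrN expr1n expr1n mul1r.
Qed.

(** The order is total, so exactly one of the two comparisons holds. Every minus sign in the
    anticommutation relations below comes from here. *)
Lemma sgn_swap p q : p != q -> (-1) ^+ ltg p q = - (-1) ^+ ltg q p :> R[i].
Proof.
move=> pq; rewrite /ltg; case: ltngtP => [||/ord_inj/enum_rank_inj /eqP];
  by rewrite ?(negbTE pq)// ?expr1 ?expr0 ?opprK.
Qed.

Lemma sgn_before_sqr S p : sgn_before R S p * sgn_before R S p = 1.
Proof. by rewrite -exprD addnn -mul2n exprM sqrrN expr1n expr1n. Qed.

Lemma xop_is_linear p : linear (@xop R t N p).
Proof.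
move=> a v w; apply/ffunP => S; rewrite !ffunE.
by case: ifP => _; rewrite ?ffunE ?scaler0 ?addr0// mulrDr; congr (_ + _); exact: mulrCA.
Qed.

Lemma dop_is_linear p : linear (@dop R t N p).
Proof.
move=> a v w; apply/ffunP => S; rewrite !ffunE.
by case: ifP => _; rewrite ?ffunE ?scaler0 ?addr0// mulrDr; congr (_ + _); exact: mulrCA.
Qed.

HB.instance Definition _ p :=
  GRing.isLinear.Build _ _ _ _ (@xop R t N p) (xop_is_linear p).
HB.instance Definition _ p :=
  GRing.isLinear.Build _ _ _ _ (@dop R t N p) (dop_is_linear p).

Lemma xop_anticomm p q v : p != q -> xop p (xop q v) = - xop q (xop p v).
Proof.
move=> pq; apply/ffunP => S; rewrite !ffunE !finset.in_setD1 (eq_sym q p) pq /=.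
case: (boolP (p \in S)) => pS; case: (boolP (q \in S)) => qS;
  rewrite ?mulr0 ?oppr0//.
have -> : S :\ q :\ p = S :\ p :\ q by rewrite !finset.setDDl finset.setUC.
rewrite !sgn_beforeD ?finset.in_setD1 ?(eq_sym q p) ?pq ?pS ?qS//.
by rewrite (sgn_swap pq); ring.
Qed.

Lemma dop_anticomm p q v : p != q -> dop p (dop q v) = - dop q (dop p v).
Proof.
move=> pq; apply/ffunP => S; rewrite !ffunE !finset.in_setU1 (eq_sym q p) (negbTE pq) /=.
case: (boolP (p \in S)) => pS; case: (boolP (q \in S)) => qS;
  rewrite ?mulr0 ?oppr0//.
have -> : q |: (p |: S) = p |: (q |: S) by rewrite finset.setUCA.
rewrite !sgn_beforeU//.
by rewrite (sgn_swap pq); ring.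
Qed.

Lemma dop_xop_anticomm p q v : p != q -> dop p (xop q v) = - xop q (dop p v).
Proof.
move=> pq; apply/ffunP => S; rewrite !ffunE !finset.in_setD1 !finset.in_setU1.
rewrite (eq_sym q p) pq (negbTE pq) /=.
case: (boolP (p \in S)) => pS; case: (boolP (q \in S)) => qS;
  rewrite ?mulr0 ?oppr0//.
have -> : (p |: S) :\ q = p |: (S :\ q).
  by apply/finset.setP=> l; rewrite !inE; case: eqP => [->|]//=; rewrite eq_sym (negbTE pq).
rewrite sgn_beforeU ?finset.in_setD1 ?(negbTE pS) ?andbF// !sgn_beforeD//.
by rewrite (sgn_swap pq); ring.
Qed.

(** At each coordinate [S] only one of the two composites survives, depending on whether [p] lies in
    [S]; its sign is a square, hence 1. *)
Lemma dop_xop_same p v : dop p (xop p v) = v - xop p (dop p v).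
Proof.
apply/ffunP => S; rewrite !ffunE !finset.in_setD1 !finset.in_setU1 eqxx /=.
case: (boolP (p \in S)) => pS.
  by rewrite finset.setD1K// mulrA sgn_before_sqr mul1r subrr.
by rewrite finset.setU1K// mulrA sgn_before_sqr mul1r subr0.
Qed.

Lemma dop_xop p q v : dop p (xop q v) = v *+ (p == q) - xop q (dop p v).
Proof.
case: eqP => [->|/eqP pq]; first by rewrite mulr1n dop_xop_same.
by rewrite mulr0n sub0r dop_xop_anticomm.
Qed.

Lemma sum_delta_pair (V : zmodType) (F G : 'I_t -> V) (i : 'I_N) (a : 'I_t) :
  \sum_b (F b *+ ((a, i) == (b, i)) - G b) = F a - \sum_b G b.
Proof.
rewrite sumrB; congr (_ - _); rewrite (bigD1 a)//= eqxx big1 ?addr0// => b ba.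
by rewrite xpair_eqE eq_sym (negbTE ba).
Qed.

(** Moving $\partial_{a,j}$ past $x_{b,j}$ leaves a delta term, which sums to $E_{ii}$. In the
    remaining term two more anticommutations restore the order
    $x_{a,i}\partial_{b,i}x_{b,j}\partial_{a,j}$ with total sign $-1$. *)
Lemma Eop_comp_Omega i j v : i != j -> Eop i j (Eop j i v) = Eop i i v - Omega i j v.
Proof.
move=> ij; have ne (a b : 'I_t) : (a, i) != (b, j) by rewrite xpair_eqE (negbTE ij) andbF.
rewrite /Eop /Omega -sumrB; apply: eq_bigr => a _.
rewrite 2![in LHS]linear_sum -[RHS](sum_delta_pair (fun b => xop (a, i) (dop (b, i) v))
    (fun b => xop (a, i) (dop (b, i) (xop (b, j) (dop (a, j) v)))) j).
apply: eq_bigr => b _ /=.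
rewrite dop_xop linearB linearMn/= dop_anticomm 1?eq_sym//.
by rewrite linearN/= -dop_xop_anticomm.
Qed.

Lemma Eop_comp_Omega_swap i j v : i != j -> Eop j i (Eop i j v) = Eop j j v - Omega i j v.
Proof.
move=> ij; have ne (a b : 'I_t) : (a, i) != (b, j) by rewrite xpair_eqE (negbTE ij) andbF.
(* The outer index of $E_{ji}E_{ij}$ corresponds to the inner index [b] of [Omega], so the double
   sum is exchanged before comparing termwise. *)
rewrite /Eop /Omega (exchange_big_dep xpredT)//= -sumrB; apply: eq_bigr => b _.
rewrite 2![in LHS]linear_sum -[RHS](sum_delta_pair (fun a => xop (b, j) (dop (a, j) v))
    (fun a => xop (a, i) (dop (b, i) (xop (b, j) (dop (a, j) v)))) i).
apply: eq_bigr => a _ /=.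
rewrite dop_xop linearB linearMn/= xop_anticomm 1?eq_sym//.
by rewrite dop_xop_anticomm ?linearN.
Qed.

Lemma EopZ i j (a : R[i]) v : Eop i j (a *: v) = a *: Eop i j v.
Proof.
by rewrite /Eop scaler_sumr; apply: eq_bigr => b _; rewrite !linearZ.
Qed.

Lemma kappaZ i j (a : R[i]) v : kappa i j (a *: v) = a *: kappa i j v.
Proof. by rewrite /kappa !EopZ scalerDr. Qed.

Lemma kappa_Omega i j v : i != j ->
  kappa i j v = Eop i i v + Eop j j v - 2 *: Omega i j v.
Proof.
move=> ij; rewrite /kappa Eop_comp_Omega// Eop_comp_Omega_swap//.
by rewrite addrACA -opprD scaler_nat mulr2n.
Qed.

(** Eliminating [Omega] by $\Omega_{ij}=E_{jj}-E_{ji}E_{ij}$ flips the sign of $E_{jj}$; hence the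
    differences $\beta_i-\beta_j$ in the gauge factor $h$. *)
Lemma kappa_EjiEij i j v : i != j ->
  kappa i j v = Eop i i v - Eop j j v + 2 *: EjiEij i j v.
Proof.
move=> ij; rewrite kappa_Omega// /EjiEij Eop_comp_Omega_swap// scalerBr.
by rewrite !scaler_nat !mulr2n addrA subrKA.
Qed.

End Fock.

(** * Algebra of the partial sums of the exponential series *)

Section ExpPartialSums.
Set Implicit Arguments.
Unset Strict Implicit.
Variable K : numFieldType.
Implicit Types (x y z : K) (n : nat).

(** The field is left general so that the same identities apply over [R[i]] and to the real
    majorants. *)
Definition exp_sum z n : K := \sum_(k < n) (z ^+ k / k`!%:R).

(** These are the terms of the product of two partial sums with $i,j<n$ but $i+j\ge n$. *)
Definition exp_tail x y n : K :=
  \sum_(0 <= i < n) \sum_(n - i <= j < n) (y ^+ i / i`!%:R) * (x ^+ j / j`!%:R).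

(** The square $i,j<n$ is cut along $i+j=n$: the binomial theorem resums the lower triangle to the
    partial sum at $x+y$. *)
Lemma exp_sumD x y n :
  exp_sum x n * exp_sum y n = exp_sum (x + y) n + exp_tail x y n.
Proof.
have fact_neq0 m : m`!%:R != 0 :> K by rewrite pnatr_eq0 -lt0n fact_gt0.
pose F i j := (y ^+ i / i`!%:R) * (x ^+ j / j`!%:R).
have -> : exp_sum (x + y) n = \sum_(0 <= i < n) \sum_(0 <= j < n - i) F i j.
  rewrite /exp_sum -(big_mkord xpredT (fun k => (x + y) ^+ k / k`!%:R)).
  transitivity (\sum_(0 <= k < n) \sum_(0 <= i < n | (i <= k)%N) F i (k - i)%N).
    apply: eq_big_nat => k /andP[_ kn].
    rewrite -(big_nat_widen 0 k.+1 n xpredT (F^~ (k - _)%N)) => //.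
    rewrite big_mkord exprDn mulr_suml; apply: eq_bigr => i _.
    have ik : (i <= k)%N by rewrite -ltnS.
    rewrite /F -(bin_fact ik) !natrM -mulr_natr.
    have := fact_neq0 i; have := fact_neq0 (k - i)%N.
    have : 'C(k, i)%:R != 0 :> K by rewrite pnatr_eq0 -lt0n bin_gt0.
    by move=> *; field; apply/and3P.
  rewrite (exchange_big_dep_nat xpredT)//=; apply: eq_big_nat => i /andP[_ lt_in].
  (* The range $k<i$ contributes nothing; on the rest, $k=i+j$ is reindexed by $j<n-i$. *)
  rewrite (@big_cat_nat _ _ _ i) ?leq0n ?(ltnW lt_in)//=.
  rewrite big_nat_cond big_pred0 ?add0r; last first.
    by move=> k; case: (leqP i k); rewrite ?andbF.
  rewrite -{1}(add0n i) big_addn big_nat_cond [RHS]big_nat_cond.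
  apply: eq_big => [j|j _]; first by rewrite leq_addl andbT.
  by rewrite addnK.
rewrite /exp_tail -big_split /=.
rewrite mulrC /exp_sum big_distrl /= -(big_mkord xpredT (fun i => y ^+ i / i`!%:R * _)).
apply: eq_big_nat => i /andP[_ lt_in].
rewrite big_distrr /= -(big_mkord xpredT (fun j => y ^+ i / i`!%:R * (x ^+ j / j`!%:R))).
by rewrite (@big_cat_nat _ _ _ (n - i)) ?leq0n ?leq_subr.
Qed.

Lemma ler_exp_tail x y n : `|exp_tail x y n| <= exp_tail `|x| `|y| n.
Proof.
apply: le_trans (ler_norm_sum _ _ _) _; apply: ler_sum => i _.
apply: le_trans (ler_norm_sum _ _ _) _; apply: ler_sum => j _.
by rewrite !(normrM, normrX, normfV) !normr_nat.
Qed.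

(** Termwise, $|z|^{2+k}/(2+k)!\le |z|^2/k!$ when $|z|\le 1$. *)
Lemma exp_sum_remainder z n : `|z| <= 1 ->
  `|exp_sum z n.+2 - 1 - z| <= `|z| ^+ 2 * exp_sum 1 n.
Proof.
move=> z1.
have -> : exp_sum z n.+2 = 1 + (z + \sum_(k < n) z ^+ (2 + k) / (2 + k)`!%:R).
  by rewrite /exp_sum !big_ord_recl !divr1.
rewrite (addrC 1) addrK (addrC z) addrK mulr_sumr.
apply: le_trans (ler_norm_sum _ _ _) _; apply: ler_sum => k _.
rewrite normf_div normrX normr_nat.
rewrite exprD expr1n -mulrA ler_wpM2l ?exprn_ge0//.
rewrite ler_pM ?invr_ge0 ?exprn_ge0 ?ler0n ?exprn_ile1//.
by rewrite lef_pV2 ?posrE ?ltr0n ?fact_gt0// ler_nat leq_fact ?leq_addl.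
Qed.

End ExpPartialSums.

(** * Limits in [R[i]] reduced to real limits *)

Section ComplexLimits.
Set Implicit Arguments.
Unset Strict Implicit.
Variable R : realType.
Local Notation C := (R[i]).

(** The order on [R[i]] is partial and positivity forces a zero imaginary part, so every epsilon in
    a complex limit is real. *)
Lemma complex_gt0 (e : C) : 0 < e -> exists2 r : R, 0 < r & e = r%:C%C.
Proof.
move=> e0; exists (complex.Re e); last by rewrite RRe_real// gtr0_real.
by move: e0; rewrite ltcE => /andP[].
Qed.

Lemma cvg_complex (u : nat -> C) (a b : R) :
  (fun n => complex.Re (u n)) @ \oo --> a -> (fun n => complex.Im (u n)) @ \oo --> b ->
  (u : nat -> C^o) @ \oo --> (Complex a b : C^o).
Proof.
move=> /cvgrPdist_lt ha /cvgrPdist_lt hb; apply/cvgrPdist_lt => e e0.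
have [r r0 ->] := complex_gt0 e0.
near=> n.
rewrite (_ : Complex a b - u n = (a - complex.Re (u n))%:C%C +
    'i%C * (b - complex.Im (u n))%:C%C); last first.
  by rewrite [LHS]complexE; case: (u n) => c d.
apply: le_lt_trans (ler_normD _ _) _; rewrite normrM.
have -> : `|'i%C : C| = 1 by rewrite normc_def /= expr0n add0r expr1n sqrtr1.
have nR (x : R) : `|x%:C%C : C| = `|x|%:C%C.
  by rewrite normc_def /= expr0n addr0 sqrtr_sqr.
rewrite mul1r !nR -rmorphD ltcR (splitr r) ltrD//.
- by near: n; apply: ha; rewrite divr_gt0.
- by near: n; apply: hb; rewrite divr_gt0.
Unshelve. all: by end_near. Qed.

Lemma cvg_norm_squeeze (u : nat -> C) (e : nat -> R) :
  (forall n, `|u n| <= (e n)%:C%C) -> e @ \oo --> 0 ->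
  (u : nat -> C^o) @ \oo --> (0 : C^o).
Proof.
move=> ue /cvgrPdist_lt he; apply/cvgrPdist_lt => d d0.
have [r r0 ->] := complex_gt0 d0.
near=> n; rewrite sub0r normrN; apply: le_lt_trans (ue n) _.
rewrite ltcR; apply: le_lt_trans (ler_norm _) _.
by rewrite -normrN -sub0r; near: n; apply: he.
Unshelve. all: by end_near. Qed.

Lemma lim_norm_le (u : nat -> C) (l : C) (M : R) :
  (u : nat -> C^o) @ \oo --> (l : C^o) -> (forall n, `|u n| <= M%:C%C) ->
  `|l| <= M%:C%C.
Proof.
(* Arguing by contradiction in the partial order is legitimate because both sides are real. *)
move=> /cvgrPdist_lt ul uM; rewrite real_leNgt ?normr_real ?complex_real//.
apply/negP => Ml; have /ul[n _ /(_ n (leqnn n))/=] : 0 < `|l| - M%:C%C by rewrite subr_gt0.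
apply/negP; rewrite -real_leNgt ?realB ?normr_real ?complex_real//.
by apply: le_trans (lerB_dist _ _); rewrite lerD2l lerN2.
Qed.

End ComplexLimits.

(** * The complex exponential: convergence, addition law, derivative *)

Section ComplexExponential.
Set Implicit Arguments.
Unset Strict Implicit.
Variable R : realType.
Local Notation C := (R[i]).
Implicit Types z x y : C.

Lemma cvg_exp_sum_expR (r : R) : exp_sum r @ \oo --> expR r.
Proof.
have -> : exp_sum r = series (exp_coeff r).
  by apply/funext => n; rewrite /exp_sum /series /= big_mkord.
exact: is_cvg_series_exp_coeff.
Qed.

Lemma exp_sum_le_expR (r : R) n : 0 <= r -> exp_sum r n <= expR r.
Proof.
move=> r0; rewrite -(cvg_lim _ (@cvg_exp_sum_expR r))//.
apply: nondecreasing_cvgn_le; last by apply: cvgP (@cvg_exp_sum_expR r).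
apply/nondecreasing_seqP => k; rewrite /exp_sum big_ord_recr /= lerDl.
by rewrite divr_ge0// exprn_ge0.
Qed.

Lemma real_complex_exp_sum (r : R) n : (exp_sum r n)%:C%C = exp_sum (r%:C%C : C) n.
Proof.
by rewrite /exp_sum rmorph_sum; apply: eq_bigr => k _; rewrite rmorphM fmorphV rmorphXn rmorph_nat.
Qed.

Lemma real_complex_exp_tail (r s : R) n :
  (exp_tail r s n)%:C%C = exp_tail (r%:C%C : C) (s%:C%C) n.
Proof.
rewrite /exp_tail rmorph_sum; apply: eq_bigr => k _; rewrite rmorph_sum.
by apply: eq_bigr => l _; rewrite !rmorphM !fmorphV !rmorphXn !rmorph_nat.
Qed.

Lemma normc_real z : exists2 r : R, 0 <= r & `|z| = r%:C%C.
Proof.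
have zE : (complex.Re `|z|)%:C%C = `|z| by rewrite RRe_real ?normr_real.
by exists (complex.Re `|z|); rewrite -?ler0c ?zE.
Qed.

Lemma cvg_expC z : (exp_sum z : nat -> C^o) @ \oo --> (expC z : C^o).
Proof.
suff : cvgn (exp_sum z : nat -> C^o) by [].
have [r r0 zr] := normc_real z.
pose c k : C := z ^+ k / k`!%:R.
have c_le k : `|c k| <= (exp_coeff r k)%:C%C.
  rewrite /exp_coeff /= rmorphM fmorphV rmorphXn rmorph_nat /= -zr.
  by rewrite normf_div normrX normr_nat.
(* Any additive functional bounded by the norm maps the series to one dominated by the real
   exponential series at $|z|$. It is used for the real and imaginary parts. *)
have part (f : {additive C -> R}) : (forall w, `|f w|%:C%C <= `|w|) ->
    exists a : R, (fun n => f (exp_sum z n)) @ \oo --> a.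
  move=> f_le.
  suff h : cvgn (fun n => f (exp_sum z n))
    by exists (limn (fun n => f (exp_sum z n))).
  have -> : (fun n => f (exp_sum z n)) = series (fun k => f (c k)).
    by apply/funext => n; rewrite /exp_sum /series /= raddf_sum big_mkord.
  apply: normed_cvg; apply: (@series_le_cvg _ _ (exp_coeff r)) => [k|k|k|].
  - exact: normr_ge0.
  - exact: exp_coeff_ge0.
  - by rewrite -lecR; apply: le_trans (f_le _) (c_le k).
  - exact: is_cvg_series_exp_coeff.
have [a ha] := part (@complex.Re R) (@normc_ge_Re R).
have [b hb] : exists b : R, (fun n => complex.Im (exp_sum z n)) @ \oo --> b.
  apply: (part (@complex.Im R)) => w; apply: le_trans (_ : `|w * 'i%C| <= _).
    by apply: le_trans (normc_ge_Re _); rewrite ReiNIm normrN.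
  by rewrite normrM [X in _ * X]normc_def /= expr0n add0r expr1n sqrtr1 mulr1.
by apply/cvg_ex; exists (Complex a b); apply: cvg_complex.
Qed.

(** The complex tail is dominated by the real tail at $|x|,|y|$, which tends to 0 because the real
    exponential already satisfies the addition law. *)
Lemma expCD x y : expC (x + y) = expC x * expC y.
Proof.
have [r r0 xr] := normc_real x; have [s s0 ys] := normc_real y.
have tail0 : exp_tail r s @ \oo --> (0 : R).
  have -> : exp_tail r s = exp_sum r \* exp_sum s - exp_sum (r + s).
    apply/funext => n; transitivity (exp_sum r n * exp_sum s n - exp_sum (r + s) n) => //.
    by rewrite exp_sumD addrAC subrr add0r.
  rewrite -(subrr (expR (r + s))) {1}expRD.
  by apply: cvgB; [apply: cvgM|]; apply: cvg_exp_sum_expR.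
have tailC0 : (exp_tail x y : nat -> C^o) @ \oo --> (0 : C^o).
  apply: cvg_norm_squeeze tail0 => n.
  by rewrite real_complex_exp_tail -xr -ys; apply: ler_exp_tail.
have lhs : (exp_sum x \* exp_sum y : nat -> C^o) @ \oo --> (expC x * expC y : C^o).
  by apply: cvgM; apply: cvg_expC.
have rhs : (exp_sum (x + y) + exp_tail x y : nat -> C^o) @ \oo --> (expC (x + y) + 0 : C^o).
  exact: (cvgD (@cvg_expC (x + y)) tailC0).
have E : exp_sum x \* exp_sum y = exp_sum (x + y) + exp_tail x y.
  by apply/funext => n; exact: exp_sumD.
rewrite E in lhs; rewrite -[LHS]addr0.
exact: (cvg_unique _ rhs lhs).
Qed.

Lemma expC0 : expC (0 : C) = 1.
Proof.
have h : (exp_sum (0 : C) : nat -> C^o) @ \oo --> (1 : C^o).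
  (* The shift skips the empty partial sum, which is 0; all later ones equal 1. *)
  rewrite -(cvg_shiftS _) /=; apply: cvg_near_cst; near=> n.
  rewrite /exp_sum big_ord_recl expr0 fact0 divr1 big1 ?addr0// => k _.
  by rewrite expr0n mul0r.
exact: (cvg_unique _ (@cvg_expC 0) h).
Unshelve. all: by end_near. Qed.

Lemma expC_sum (I : Type) (r : seq I) (P : pred I) (F : I -> C) :
  expC (\sum_(i <- r | P i) F i) = \prod_(i <- r | P i) expC (F i).
Proof. exact: (big_morph _ expCD expC0). Qed.

Lemma expC_neq0 x : expC x != 0.
Proof.
have h : expC (- x) * expC x = 1 by rewrite -expCD addNr expC0.
by apply/eqP => x0; move: h; rewrite x0 mulr0 => /esym/eqP; rewrite oner_eq0.
Qed.

Lemma expCN x : expC (- x) = (expC x)^-1.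
Proof.
by apply: (mulIf (expC_neq0 x)); rewrite -expCD addNr expC0 mulVf ?expC_neq0.
Qed.

Lemma expC_remainder z : `|z| <= 1 ->
  `|expC z - 1 - z| <= `|z| ^+ 2 * (expR (1 : R))%:C%C.
Proof.
move=> z1; have [r r0 zr] := normc_real z.
have h : (fun n => exp_sum z n.+2 - 1 - z : C^o) @ \oo --> (expC z - 1 - z : C^o).
  have h2 : (fun n => exp_sum z n.+2 : C^o) @ \oo --> (expC z : C^o).
    rewrite (cvg_shiftS (fun n => exp_sum z n.+1 : C^o)) cvg_shiftS.
    exact: cvg_expC.
  exact: cvgB (cvgB h2 (@cvg_cst C^o 1 nat \oo _)) (@cvg_cst C^o z nat \oo _).
rewrite zr -rmorphXn -rmorphM; apply: lim_norm_le h _ => n.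
apply: le_trans (exp_sum_remainder _ z1) _.
rewrite zr rmorphM rmorphXn /= ler_wpM2l ?exprn_ge0 ?ler0c//.
by rewrite -(rmorph1 (real_complex R)) -real_complex_exp_sum lecR exp_sum_le_expR.
Qed.

(** By the addition law the error of the difference quotient is $h^{-1}(e^h-1-h)e^z$ up to sign, of
    norm at most $|h|\,e\,|e^z|$ for $|h|\le 1$. *)
Lemma is_derive_expC z : is_derive (z : C^o) 1 (@expC R : C^o -> C^o) (expC z).
Proof.
suff h : (fun h : C^o => h^-1 *: ((expC (h *: 1 + z) : C^o) - expC z)) @ (0 : C^o)^' --> (expC z : C^o).
  by apply: DeriveDef; [apply: cvgP h | apply: cvg_lim h; exact: norm_hausdorff].
have e1 : (0 : C) < (expR 1)%:C%C by rewrite ltcR expR_gt0.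
apply/cvgrPdist_lt => e e0; near=> h.
have h0 : h != 0 by near: h; exact: nbhs_dnbhs_neq.
have -> : expC z - h^-1 *: (expC (h *: 1 + z) - expC z) = - (h^-1 * (expC h - 1 - h) * expC z).
  by rewrite scaler1 expCD /GRing.scale/=; field.
rewrite normrN !normrM normfV.
have h1 : `|h| <= 1.
  by near: h; apply: dnbhs0_le.
apply: (@le_lt_trans _ _ (`|h| * ((expR 1)%:C%C * `|expC z|))).
  rewrite mulrA ler_wpM2r// mulrC ler_pdivrMr ?normr_gt0//.
  by rewrite mulrAC -expr2 expC_remainder.
rewrite -ltr_pdivlMr; last by rewrite mulr_gt0// normr_gt0 expC_neq0.
by near: h; apply: dnbhs0_lt; rewrite divr_gt0// mulr_gt0// normr_gt0 expC_neq0.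
Unshelve. all: by end_near. Qed.

End ComplexExponential.

(** * Differentiation of logarithm branches and scalar gauge factors *)

Section Connections.
Set Implicit Arguments.
Unset Strict Implicit.
Variables (R : realType) (N : nat).
Local Notation C := (R[i]).
Local Notation V := ('rV[C]_N : normedModType C).
Implicit Types (z : 'rV[C]_N) (k : 'I_N).

Lemma is_derive_expC_comp (W : normedModType C) (F : W -> C^o) (z v : W) : differentiable F z ->
  is_derive z v (fun w => expC (F w) : C^o) (expC (F z) * 'D_v F z).
Proof.
move=> dF; have [dE DE] := is_derive_expC (F z).
have dE' : differentiable (@expC R : C^o -> C^o) (F z) by apply/derivable1_diffP.
have dEF := differentiable_comp dF dE'.
apply: DeriveDef; first exact: diff_derivable.
rewrite deriveE// -/(@expC R \o F) diff_comp//= -(deriveE _ dF).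
have := congr1 (fun g : C -> C^o => g ('D_v F z)) (deriv1E dE).
by rewrite derive1E DE => ->; rewrite mulrC.
Qed.

Lemma differentiable_bigsum (W U : normedModType C) (I : Type) (r : seq I) (P : pred I)
    (F : I -> W -> U) (z : W) : (forall i, P i -> differentiable (F i) z) ->
  differentiable (fun w => \sum_(i <- r | P i) F i w) z.
Proof.
move=> dF; elim: r => [|i r IHr].
  under eq_fun do rewrite big_nil.
  exact: differentiable_cst.
have -> : (fun w => \sum_(j <- i :: r | P j) F j w) =
    (if P i then F i + (fun w => \sum_(j <- r | P j) F j w)
     else fun w => \sum_(j <- r | P j) F j w).
  by apply/funext => w; rewrite big_cons; case: (P i).
case: ifPn => // Pi.
exact: (differentiableD (dF i Pi) IHr).
Qed.

Lemma is_derive_bigsum (W U : normedModType C) (I : Type) (r : seq I) (P : pred I)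
    (F : I -> W -> U) (dF : I -> U) (z v : W) :
  (forall i, P i -> is_derive z v (F i) (dF i)) ->
  is_derive z v (fun w => \sum_(i <- r | P i) F i w) (\sum_(i <- r | P i) dF i).
Proof.
move=> hF; elim: r => [|i r IHr].
  rewrite big_nil; under eq_fun do rewrite big_nil.
  exact: is_derive_cst.
have -> : (fun w => \sum_(j <- i :: r | P j) F j w) =
    (if P i then F i + (fun w => \sum_(j <- r | P j) F j w)
     else fun w => \sum_(j <- r | P j) F j w).
  by apply/funext => w; rewrite big_cons; case: (P i).
rewrite big_cons; case: ifPn => // Pi.
exact: (is_deriveD (hF i Pi) IHr).
Qed.

Lemma is_derive_coord z (v : 'rV[C]_N) (i : 'I_N) :
  is_derive (z : V) v (fun w : V => w ord0 i : C^o) (v ord0 i).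
Proof.
have h : (fun h : C^o => h^-1 *: (((h *: v + z) ord0 i : C^o) - z ord0 i)) @ (0 : C^o)^' --> (v ord0 i : C^o).
  apply: cvg_near_cst; near=> h.
  have h0 : h != 0 by near: h; exact: nbhs_dnbhs_neq.
  by rewrite !mxE addrK /GRing.scale/= mulKf.
by apply: DeriveDef; [apply: cvgP h | apply: cvg_lim h; exact: norm_hausdorff].
Unshelve. all: by end_near. Qed.

Variables (D : set 'rV[C]_N) (L : 'I_N -> 'I_N -> 'rV[C]_N -> C).
Hypothesis D_open : open (D : set V).
Hypothesis L_log : forall i j : 'I_N, (i < j)%N -> log_branch D i j (L i j).

(** Differentiate $\exp L_{ij}=z_i-z_j$ and divide by $z_i-z_j$, nonzero as a value of the
    exponential. *)
Lemma derive_log_branch z k (i j : 'I_N) : (i < j)%N -> D z ->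
  'D_(@ek R N k) (L i j : V -> C^o) z = ((i == k)%:R - (j == k)%:R) / (z ord0 i - z ord0 j).
Proof.
move=> ij Dz; have [/(_ z Dz) dL eL] := L_log ij.
have [_] := is_derive_expC_comp (@ek R N k) dL.
rewrite (eL z Dz) => h.
have zij : z ord0 i - z ord0 j != 0 by rewrite -(eL z Dz) expC_neq0.
apply: (mulfI zij); rewrite -h mulrCA mulfV// mulr1.
transitivity ('D_(@ek R N k) (fun w : V => w ord0 i - w ord0 j : C^o) z).
  (* Since [D] is open, the branch identity holds in a whole neighbourhood of [z], so it may be
     differentiated. *)
  apply: (@near_eq_derive C V C^o _ _ (z : V)); near=> w; apply: eL; near: w.
  exact: open_nbhs_nbhs.
have [_ ->] := is_deriveB (is_derive_coord z (@ek R N k) i) (is_derive_coord z (@ek R N k) j).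
by rewrite !mxE.
Unshelve. all: by end_near. Qed.

(** Its exponential is the gauge factor $\prod_{i<j}(z_i-z_j)^{c_{ij}}$ for the chosen branches. *)
Definition log_form (c : 'I_N -> 'I_N -> C) z : C :=
  \sum_(i < N) \sum_(j < N | (i < j)%N) c i j * L i j z.

Lemma is_derive_log_form c z k : D z ->
  is_derive (z : V) (@ek R N k) (log_form c : V -> C^o)
    (\sum_(i < N) \sum_(j < N | (i < j)%N)
       c i j * (((i == k)%:R - (j == k)%:R) / (z ord0 i - z ord0 j))).
Proof.
move=> Dz; apply: is_derive_bigsum => i _; apply: is_derive_bigsum => j ij.
have [/(_ z Dz) dL _] := L_log ij; rewrite -derive_log_branch//.
exact: (@is_deriveZ C V C^o (L i j) (c i j) z (@ek R N k) _
  (derivableP (@diff_derivable C V C^o _ _ _ dL))).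
Qed.

Lemma differentiable_log_form c z : D z ->
  differentiable (log_form c : V -> C^o) (z : V).
Proof.
move=> Dz; apply: differentiable_bigsum => i _; apply: differentiable_bigsum => j ij.
have [/(_ z Dz) dL _] := L_log ij.
exact: (differentiableZ _ dL).
Qed.

Variable t : nat.

Lemma conn_scale c z k (v : Lam R t N) :
  conn (fun i j w => c i j *: w) z k v =
  (\sum_(i < N) \sum_(j < N | (i < j)%N)
     c i j * (((i == k)%:R - (j == k)%:R) / (z ord0 i - z ord0 j))) *: v.
Proof.
rewrite /conn scaler_suml; apply: eq_bigr => i _; rewrite scaler_suml.
by apply: eq_bigr => j _; rewrite scalerA mulrC.
Qed.

Lemma conn_scalable (P : 'I_N -> 'I_N -> Lam R t N -> Lam R t N) z k (a : C) v :
  (forall i j, P i j (a *: v) = a *: P i j v) ->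
  conn P z k (a *: v) = a *: conn P z k v.
Proof.
move=> PZ; rewrite /conn scaler_sumr; apply: eq_bigr => i _; rewrite scaler_sumr.
by apply: eq_bigr => j _; rewrite PZ !scalerA mulrC.
Qed.

(** The operator relation is required only at the given [v], so that $E_{ii}$ can be replaced by its
    weight there. *)
Lemma conn_relation (P Q T : 'I_N -> 'I_N -> Lam R t N -> Lam R t N) z k (a b : C) v :
  (forall i j : 'I_N, (i < j)%N -> P i j v + a *: Q i j v = b *: T i j v) ->
  conn P z k v + a *: conn Q z k v = b *: conn T z k v.
Proof.
move=> PQT; rewrite /conn !scaler_sumr -big_split; apply: eq_bigr => i _ /=.
rewrite !scaler_sumr -big_split; apply: eq_bigr => j ij /=.
by set x := _ / _; rewrite !scalerA ![_ * x]mulrC -!(scalerA x) -scalerDr PQT.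
Qed.

(** Leibniz rule in each coordinate: the logarithmic derivative of the gauge factor is a scalar
    connection form with coefficients [c]. *)
Lemma pd_gauge c (f : 'rV[C]_N -> Lam R t N) z k : holo D f -> D z ->
  pd k (fun w => expC (log_form c w) *: f w) z =
  expC (log_form c z) *: (pd k f z + conn (fun i j v => c i j *: v) z k (f z)).
Proof.
move=> hf Dz; apply/ffunP => S; rewrite !ffunE.
have dE := is_derive_expC_comp (@ek R N k) (differentiable_log_form c Dz).
have df : derivable ((fun w => f w S) : V -> C^o) z (@ek R N k).
  exact/diff_derivable/hf.
transitivity ('D_(@ek R N k) ((fun w => expC (log_form c w) : C^o) * (fun w => f w S : C^o)) z).
  apply: (congr1 (fun F : V -> C^o => 'D_(@ek R N k) F z)).
  by apply/funext => w; rewrite ffunE.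
have [_ ->] := @is_deriveM C V _ _ _ _ _ _ dE (derivableP df).
have [_ ->] := is_derive_log_form c k Dz.
rewrite conn_scale !ffunE [RHS]mulrDr; congr (_ + _).
exact: etrans (mulrC _ _) (esym (mulrA _ _ _)).
Qed.

End Connections.

(** * Gauge equivalence of the three connections *)

Theorem theorem3p3 (R : realType) (t m n : nat)
  (ht : (0 < t)%N) (hm : (0 < m)%N) (hn : (0 < n)%N)
  (alpha : 'I_t -> R[i]) (beta : 'I_(m + n) -> R[i]) (hbar : R[i])
  (D : set 'rV[R[i]]_(m + n)) (hDo : open (D : set ('rV[R[i]]_(m + n) : normedModType R[i]))) (hDU : (D `<=` @Uconf R (m + n))%classic)
  (L : 'I_(m + n) -> 'I_(m + n) -> 'rV[R[i]]_(m + n) -> R[i])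
  (hL : forall i j : 'I_(m + n), (i < j)%N -> log_branch D i j (L i j)) :
  (* flat sections of nabla_KZ  <->  flat sections of nabla_kappa *)
  (forall f : 'rV[R[i]]_(m + n) -> Lam R t (m + n),
     holo D f -> (forall z, D z -> inM alpha beta (f z)) ->
     let g := fun z => (\prod_(i < m + n) \prod_(j < m + n | (i < j)%N)
                          expC (- ((beta i + beta j) * hbar / 2) * L i j z)) *: f z in
     flat D (- hbar) (@Omega R t (m + n)) f <-> flat D (hbar / 2) (@kappa R t (m + n)) g)
  /\
  (* gauge transform:  h nabla_kappa h^{-1} = nabla_D  on M_{alpha,beta} *)
  (let h := fun z => expC (hbar / 2 * \sum_(i < m + n) \sum_(j < m + n | (i < j)%N)
                                         (beta i - beta j) * L i j z) in
   forall s : 'rV[R[i]]_(m + n) -> Lam R t (m + n),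
     holo D s -> (forall z, D z -> inM alpha beta (s z)) ->
     forall z, D z -> forall k : 'I_(m + n),
       h z *: (pd k (fun w => (h w)^-1 *: s w) z
               + (hbar / 2) *: conn (@kappa R t (m + n)) z k ((h z)^-1 *: s z))
       = pd k s z + hbar *: conn (@EjiEij R t (m + n)) z k (s z)).
Proof.
split=> [f hf fM g|h s hs sM z Dz k].
- pose c i j : R[i] := - ((beta i + beta j) * hbar / 2).
  have gE : g = fun z => expC (log_form L c z) *: f z.
    apply/funext => z; rewrite /log_form expC_sum /g; congr (_ *: _).
    by apply: eq_bigr => i _; rewrite expC_sum.
  (* This is the covariance $\nabla_\kappa g=e^{\ell}\,\nabla_{KZ}f$, with $\ell$ the function
     [log_form L c]; as $e^{\ell}$ never vanishes, it gives both directions of the equivalence. *)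
  have key z k : D z ->
      pd k g z + (hbar / 2) *: conn (@kappa R t (m + n)) z k (g z) =
      expC (log_form L c z) *: (pd k f z + - hbar *: conn (@Omega R t (m + n)) z k (f z)).
    move=> Dz; have [_ fb] := fM z Dz.
    rewrite gE (pd_gauge hDo hL)// conn_scalable; last by move=> i j; exact: kappaZ.
    rewrite scalerA mulrC -scalerA -scalerDr -addrA; congr (_ *: (_ + _)).
    apply: conn_relation => i j ij; rewrite kappa_Omega ?neq_ltn ?ij// !fb.
    rewrite scalerBr -scalerDl !scalerA addrA -scalerDl -scaleNr.
    (* The exponent cancels the weight part $\frac{\hbar}{2}(\beta_i+\beta_j)$ of
       $\frac{\hbar}{2}\kappa_{ij}$, leaving $-\hbar\,\Omega_{ij}$. *)
    rewrite (_ : c i j + _ = 0) ?scale0r ?add0r; last by rewrite /c; field.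
    by congr (_ *: _); field.
  split=> fl z Dz k.
    by rewrite key// fl// scaler0.
  by apply: (scalerI (expC_neq0 (log_form L c z))); rewrite -key// fl// scaler0.
(* The sign is negative because the section is multiplied by $h^{-1}$ before differentiation. *)
- pose c i j : R[i] := - (hbar / 2 * (beta i - beta j)).
  have hE w : (h w)^-1 = expC (log_form L c w).
    rewrite /h -expCN; congr expC; rewrite mulr_sumr -sumrN; apply: eq_bigr => i _.
    by rewrite mulr_sumr -sumrN; apply: eq_bigr => j _; rewrite mulrA mulNr.
  have hz : h z != 0 by exact: expC_neq0.
  have [_ sb] := sM z Dz.
  under eq_fun do rewrite hE.
  rewrite (pd_gauge hDo hL)// conn_scalable; last by move=> i j; exact: kappaZ.
  rewrite -hE scalerA mulrC -scalerA -scalerDr scalerA mulfV// scale1r -addrA; congr (_ + _).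
  apply: conn_relation => i j ij; rewrite kappa_EjiEij ?neq_ltn ?ij// !sb.
  rewrite scalerDr -scalerBl !scalerA addrA -scalerDl.
  (* Here the cancelled weight part is $\frac{\hbar}{2}(\beta_i-\beta_j)$, leaving
     $\hbar\,E_{ji}E_{ij}$. *)
  rewrite (_ : c i j + _ = 0) ?scale0r ?add0r; last by rewrite /c; field.
  by congr (_ *: _); field.
Qed.
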